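(* Let $d\ge1$, let $I$ be a compact interval, fix a shape $s_1s_2\cdots s_{d+1}$, and let $W\subset I^d$ be the parameter space of all critical value vectors $w$ for this shape. Then the set $$\{w\in W : P(S_w)=\{2^n : n\in\mathbb{N}\}\}$$ has no interior point in the parameter space $W$.
   Context: $\mathbb{N}$ includes $0$. A point $x$ is a periodic point of period $n\ge 1$ of a map $f$ if $f^n(x)=x$ and $f^i(x)\ne x$ for $0<i<n$; $P(f)$ denotes the set of periods of all periodic points of $f$. Sawtooth maps. Let $s_1,\dots,s_{d+1}\in\{+,-\}$ with $s_{i+1}=-s_i$. The sawtooth map of shape $s_1s_2\cdots s_{d+1}$ is the unique continuous piecewise linear map $S_d:I\to I$ with successive slopes $s_1(d+1),s_2(d+1),\dots,s_{d+1}(d+1)$; that is, $I=[c_0,c_{d+1}]$ is divided by points $c_0<c_1<\dots<c_{d+1}$ into $d+1$ intervals (''laps'') $[c_{j-1},c_j]$ of equal length, and $S_d$ maps each lap $[c_{j-1},c_j]$ affinely onto $I$ with slope $s_j(d+1)$. Critical value vectors. A critical value vector (for the given shape) is $w=(w_1,\dots,w_d)\in I^d$ satisfying $(w_j-w_{j+1})\cdot s_{j+1}<0$ for $j=1,\dots,d-1$ (the sign $s_{j+1}$ being read as $\pm1$). Stunted sawtooth maps. $S_w$ is obtained from $S_d$ by cutting off the tops and bottoms of the graph at the heights $w_j$: if $s_j=+$ (so $c_j$ is a local maximum of $S_d$), on the two laps adjacent to $c_j$ the values of $S_d$ larger than $w_j$ are replaced by $w_j$; if $s_j=-$ (so $c_j$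 is a local minimum of $S_d$), on the two laps adjacent to $c_j$ the values of $S_d$ smaller than $w_j$ are replaced by $w_j$; this is done for all $j=1,\dots,d$. *)

(* Defs.v *)
From HB Require Import structures.
From mathcomp Require Import all_boot all_order all_algebra.
From mathcomp Require Import all_classical all_reals all_analysis.

Set Implicit Arguments.
Unset Strict Implicit.
Unset Printing Implicit Defensive.

Import Order.TTheory GRing.Theory Num.Theory.
Import numFieldNormedType.Exports.

Local Open Scope classical_set_scope.
Local Open Scope ring_scope.

Definition periodic_point {T : Type} (f : T -> T) (n : nat) (x : T) : Prop :=
  [/\ (0 < n)%N, iter n f x = x &
      forall i : nat, (0 < i < n)%N -> iter i f x <> x].

(* P(f) for the self-map of D induced by f; only points of D are counted. *)
Definition periods {T : Type} (D : set T) (f : T -> T) : set nat :=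
  [set n | exists2 x, D x & periodic_point f n x].

(* Indices are 0-based: [s i] is the sign s_{i+1} (true for +, false for -), *)
(* and for w : 'rV_d the entry [w 0 i] is w_{i+1}.                           *)
Definition alternating_shape (d : nat) (s : 'I_d.+1 -> bool) : Prop :=
  forall i j : 'I_d.+1, j = i.+1 :> nat -> s j = ~~ s i.

Definition pm {R : pzRingType} (s : bool) : R := if s then 1 else -1.

(* For i : 'I_d, the sign s_{i+1} of the lap to the left of c_{i+1}. *)
Definition sign_at (d : nat) (s : 'I_d.+1 -> bool) (i : 'I_d) : bool :=
  s (widen_ord (leqnSn d) i).

(* The division point c_k (0 <= k <= d + 1) of [a, b]. *)
Definition cpt {R : realType} (a b : R) (d k : nat) : R :=
  a + k%:R * ((b - a) / d.+1%:R).

Definition sawtooth {R : realType} (a b : R) (d : nat) (s : 'I_d.+1 -> bool)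
    (x : R) : R :=
  if [pick k : 'I_d.+1 | cpt a b d k <= x <= cpt a b d k.+1] is Some k
  then (if s k then a else b) + pm (s k) * d.+1%:R * (x - cpt a b d k)
  else a. (* junk value: x is not in [a, b] *)

(* The choice made by [pick] at a point common to two laps is immaterial. *)
Lemma sawtooth_lap (R : realType) (a b : R) (d : nat) (s : 'I_d.+1 -> bool)
    (k : 'I_d.+1) (x : R) :
  a < b -> alternating_shape s -> cpt a b d k <= x <= cpt a b d k.+1 ->
  sawtooth a b s x =
    (if s k then a else b) + pm (s k) * d.+1%:R * (x - cpt a b d k).
Proof.
move=> ab sP xk; rewrite /sawtooth; case: pickP => [j xj|/(_ k)]; last first.
  by rewrite xk.
have d0 : d.+1%:R != 0 :> R by rewrite pnatr_eq0.
have h0 : 0 < (b - a) / d.+1%:R by rewrite divr_gt0 ?subr_gt0 ?ltr0n.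
have hE : d.+1%:R * ((b - a) / d.+1%:R) = b - a by rewrite mulrC divfK.
have cle m n : (cpt a b d m <= cpt a b d n) = (m <= n)%N.
  by rewrite lerD2l ler_pM2r // ler_nat.
have glue (i l : 'I_d.+1) : (i < l)%N -> cpt a b d i <= x <= cpt a b d i.+1 ->
    cpt a b d l <= x <= cpt a b d l.+1 ->
    (if s i then a else b) + pm (s i) * d.+1%:R * (x - cpt a b d i) =
    (if s l then a else b) + pm (s l) * d.+1%:R * (x - cpt a b d l).
  move=> il /andP[_ xi] /andP[xl _].
  have li : nat_of_ord l = i.+1.
    by apply/eqP; rewrite eqn_leq il andbT -cle (le_trans xl xi).
  have -> : x = cpt a b d i.+1 by apply/eqP; rewrite eq_le xi -li.
  rewrite (sP _ _ li) li subrr mulr0 addr0.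
  have -> : cpt a b d i.+1 - cpt a b d i = (b - a) / d.+1%:R.
    by rewrite /cpt -natr1 mulrDl mul1r addrA [X in X - _]addrC addrK.
  rewrite -mulrA hE; case: (s i) => /=; first by rewrite mul1r addrC subrK.
  by rewrite mulN1r opprB addrC subrK.
case: (ltngtP j k) => [jk|kj|/ord_inj -> //]; first exact: glue.
by symmetry; apply: glue.
Qed.

Definition critical_value_vectors {R : realType} (a b : R) (d : nat)
    (s : 'I_d.+1 -> bool) : set 'rV[R]_d :=
  [set w | (forall i : 'I_d, a <= w 0 i <= b) /\
           (forall i j : 'I_d, j = i.+1 :> nat ->
              (w 0 i - w 0 j) * pm (sign_at s j) < 0)].

(* Successively for each i, cut at height w_{i+1} on [c_i, c_{i+2}], the      *)
(* union of the two laps adjacent to c_{i+1}. For a critical value vector the *)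
(* order of the cuts is immaterial: on a lap every lower height is smaller    *)
(* than every upper one.                                                      *)
Definition stunted {R : realType} (a b : R) (d : nat) (s : 'I_d.+1 -> bool)
    (w : 'rV[R]_d) (x : R) : R :=
  foldl (fun (v : R) (i : 'I_d) =>
           if cpt a b d i <= x <= cpt a b d i.+2 then
             if sign_at s i then Num.min v (w 0 i) else Num.max v (w 0 i)
           else v)
        (sawtooth a b s x) (enum 'I_d).

(* Main.v *)
Require Import Defs.
From HB Require Import structures.
From mathcomp Require Import all_boot all_order all_algebra.
From mathcomp Require Import all_classical all_reals all_analysis.
From mathcomp Require Import zify ring lra.

Set Implicit Arguments.
Unset Strict Implicit.
Unset Printing Implicit Defensive.

Import Order.TTheory GRing.Theory Num.Theory.
Import numFieldNormedType.Exports.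

Local Open Scope classical_set_scope.
Local Open Scope ring_scope.

(** Round each critical value down to a lattice a + hZ, with h a fraction of
    the lap length: this gives critical value vectors w' as close as desired to
    any given w, so it is enough to see that no w' with lattice entries has
    {2^n} as its set of periods ([stunted_lattice_periods]).

    For such a w' the map f = S_{w'} sends lattice points to lattice points,
    and the whole dynamics is Markov with respect to the lattice: on a gap
    between consecutive lattice points f is affine of slope +-(d+1) wherever it
    takes a value outside the lattice, and its image contains every gap that it
    meets.  So if an orbit avoids the lattice, every iterate of f along it has
    an affine inverse branch, a contraction, from the closed gap of the end of
    the orbit segment into the closed gap of its beginning
    ([stunted_gap_branches], [iter_gap_branches]).

    If all powers of 2 were periods, there would be an orbit whose period
    p = 2^k exceeds the number of gaps.  It has two distinct points u, v in the
    same gap J, and it avoids the lattice.  Hence g = f^p has two inverse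
    branches psi_u, psi_v : J -> J, fixing u and v respectively: a horseshoe.
    The fixed point z of psi_u psi_u psi_v satisfies g^3 z = z and g z <> z
    ([affine_horseshoe_period3]), so the f-period of z divides 3 * 2^k but not
    2^k, and it is not a power of 2 ([period3_not_pow2]). *)

(** * Periods of iterates *)

Lemma periodic_point_dvd (T : Type) (f : T -> T) (n m : nat) (x : T) :
  periodic_point f n x -> iter m f x = x -> (n %| m)%N.
Proof.
move=> [n0 fn nmin] fm.
have fq k : iter (k * n) f x = x.
  by elim: k => //= k IH; rewrite mulSn iterD IH.
have fr : iter (m %% n)%N f x = x.
  by rewrite -[RHS]fm {2}(divn_eq m n) addnC iterD fq.
rewrite /dvdn; case: posnP => // r0.
by case: (nmin (m %% n)%N); rewrite ?r0 ?ltn_mod.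
Qed.

Lemma exists_period (T : eqType) (f : T -> T) (m : nat) (x : T) :
  (0 < m)%N -> iter m f x = x -> exists n, periodic_point f n x.
Proof.
move=> m0 fm.
have ex : exists n, (0 < n)%N && (iter n f x == x) by exists m; rewrite m0 fm /=.
case: (ex_minnP ex) => n /andP[n0 /eqP fn] nmin; exists n; split=> // i.
move=> /andP[i0 ilt] fi; move: (nmin i); rewrite i0 fi eqxx => /(_ isT).
by rewrite leqNgt ilt.
Qed.

(** The least period divides 3 * 2^k; a power of 2 dividing 3 * 2^k divides
    2^k, and would make z a fixed point of the 2^k-th iterate. *)
Lemma period3_not_pow2 (T : eqType) (f : T -> T) (k : nat) (z : T) :
  iter 3 (iter (2 ^ k) f) z = z -> iter (2 ^ k) f z <> z ->
  exists2 n, periodic_point f n z & ~ range (fun j : nat => (2 ^ j)%N) n.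
Proof.
rewrite -iterM => f3 f1.
have [||n fn] := @exists_period _ f (3 * 2 ^ k) z; rewrite ?muln_gt0 ?expn_gt0 //.
exists n => // -[j _ nE]; subst n; apply: f1.
have jk : (2 ^ j %| 2 ^ k)%N.
  by rewrite -(@Gauss_dvdr _ 3) ?coprimeXl //; exact: periodic_point_dvd f3.
case: (fn) => _ fj _.
by rewrite -(divnK jk) iterM; elim: (_ %/ _)%N => //= q ->.
Qed.

(** * A horseshoe with affine branches *)

(** An endpoint of the interval on the near side of an outside fixed point z
    would be moved closer to z, hence out of the interval; so it suffices to
    control the images of the two endpoints. *)
Lemma affine_contraction_fixpoint_itv (R : realFieldType) (c z p r : R) :
  `|c| < 1 -> p <= z + c * (p - z) -> z + c * (r - z) <= r -> p <= z <= r.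
Proof.
rewrite ltr_norml => /andP[c1 c2] hp hr; rewrite !leNgt.
by apply/andP; split; apply/negP => hz; nra.
Qed.

(** The point z has itinerary u u v: it is fixed by psi_u psi_u psi_v, where
    psi_u and psi_v are the inverse branches of g with fixed points u and v.
    If g fixed z, then z would be fixed by psi_u and by psi_v, and each of these
    contractions has only one fixed point. *)
Lemma affine_horseshoe_period3 (R : realFieldType) (g : R -> R)
    (p r u v c e : R) :
  u != v -> `|c| < 1 -> `|e| < 1 -> p <= r ->
  (forall y, p <= y <= r ->
     p <= u + c * (y - u) <= r /\ g (u + c * (y - u)) = y) ->
  (forall y, p <= y <= r ->
     p <= v + e * (y - v) <= r /\ g (v + e * (y - v)) = y) ->
  exists z, [/\ p <= z <= r, iter 3 g z = z & g z <> z].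
Proof.
move=> uv c1 e1 pr hu hv.
pose al := c * c * e.
have al1 : `|al| < 1.
  rewrite /al !normrM -[ltRHS]mulr1 ltr_pM ?mulr_ge0 //.
  by rewrite -[ltRHS]mulr1 ltr_pM.
have al0 : 1 - al != 0 by rewrite subr_eq0 gt_eqF //; case/ltr_normlP: al1.
(* z solves the affine equation psi z = z, where psi has slope al. *)
pose z := (u + c * c * (v - u) - al * v) / (1 - al).
pose psi y := u + c * (u + c * (v + e * (y - v) - u) - u).
have psiE y : psi y = z + al * (y - z).
  have -> : z + al * (y - z) = z * (1 - al) + al * y by ring.
  by rewrite divfK // /psi /al; ring.
have psi_in y : p <= y <= r -> p <= psi y <= r.
  by move=> yin; have [y1 _] := hv _ yin; have [y2 _] := hu _ y1; have [] := hu _ y2.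
have zin : p <= z <= r.
  apply: (@affine_contraction_fixpoint_itv _ al) => //; rewrite -psiE.
    by have /psi_in/andP[] : p <= p <= r by rewrite lexx.
  by have /psi_in/andP[] : p <= r <= r by rewrite pr lexx.
have zE : psi z = z by rewrite psiE subrr mulr0 addr0.
have [h1 g1] := hv _ zin; have [h2 g2] := hu _ h1; have [h3 g3] := hu _ h2.
have gz : g z = u + c * (v + e * (z - v) - u) by rewrite -[in LHS]zE.
exists z; split=> //=; first by rewrite gz g2.
move=> gzz.
have fixpt x t : `|t| < 1 -> x + t * (z - x) = z -> z = x.
  move=> t1 tz; apply/eqP; rewrite -subr_eq0.
  have : (1 - t) * (z - x) = z - (x + t * (z - x)) by ring.
  rewrite tz subrr.
  move/eqP; rewrite mulf_eq0 => /orP[|//].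
  by move/eqP=> t1E; move: t1; rewrite (_ : t = 1) ?normr1 ?ltxx //; lra.
have zu : z = u by apply: (fixpt _ c) => //; rewrite -[in RHS]zE /psi -gz gzz.
have zv : z = v by apply: (fixpt _ e) => //; rewrite -g2 -gz !gzz.
by case/eqP: uv; rewrite -zu -zv.
Qed.

(** * Gaps of a lattice and inverse branches over them *)

Definition lattice {R : realType} (a h : R) : set R :=
  [set x | (x - a) / h \is a Num.int].

Definition is_gap {R : realType} (L : set R) (p r : R) : Prop :=
  [/\ L p, L r, p < r & forall l, L l -> l <= p \/ r <= l].

Lemma lattice_gap (R : realType) (a h x : R) :
  let m := Num.truncn ((x - a) / h) in
  0 < h -> a <= x -> ~ lattice a h x ->
  is_gap (lattice a h) (a + m%:R * h) (a + m.+1%:R * h) /\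
  a + m%:R * h < x < a + m.+1%:R * h.
Proof.
move=> m h0 ax xL.
have hn : h != 0 by rewrite gt_eqF.
have LE n : (a + n%:R * h - a) / h = n%:R by rewrite addrAC subrr add0r mulfK.
have /truncn_itv/andP[] : 0 <= (x - a) / h by rewrite divr_ge0 ?subr_ge0 // ltW.
rewrite -/m ler_pdivlMr // ltr_pdivrMr // lerBrDl ltrBlDl => mx xm.
split; last first.
  rewrite xm andbT lt_neqAle mx andbT; apply/eqP => xE; apply: xL.
  by rewrite /lattice /= -xE LE natr_int.
split; rewrite /lattice /= ?LE ?natr_int //.
  by rewrite ltrD2l ltr_pM2r // ltr_nat.
move=> l /intrP[n lE].
have {lE} -> : l = a + n%:~R * h by rewrite -lE divfK // addrC subrK.
rewrite !lerD2l !ler_pM2r // -[m%:R]/((m%:Z)%:~R) -[m.+1%:R]/((m.+1%:Z)%:~R).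
rewrite !ler_int; lia.
Qed.

(** The Markov property in the form used here: whenever f maps a point x of a
    gap into a gap, it has an affine contracting inverse branch through x
    defined over the closure of the image gap.  Closed gaps are needed because
    the fixed point of a composition of branches may be an endpoint. *)
Definition gap_branches {R : realType} (L D : set R) (f : R -> R) : Prop :=
  forall x p r p' r', D x -> is_gap L p r -> is_gap L p' r' ->
    p < x < r -> p' < f x < r' ->
  exists2 c, `|c| < 1 & forall y, p' <= y <= r' ->
    p <= x + c * (y - f x) <= r /\ f (x + c * (y - f x)) = y.

(** Branches compose along an orbit that avoids L, since each point of the
    orbit then lies inside a gap. *)
Lemma iter_gap_branches (R : realType) (L D : set R) (f : R -> R) (n : nat) :
  (forall x, D x -> ~ L x -> exists p r, is_gap L p r /\ p < x < r) ->
  (forall x, D x -> D (f x)) -> gap_branches L D f ->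
  forall x p r p' r', D x -> (forall i, ~ L (iter i f x)) ->
    is_gap L p r -> is_gap L p' r' -> p < x < r -> p' < iter n.+1 f x < r' ->
  exists2 c, `|c| < 1 & forall y, p' <= y <= r' ->
    p <= x + c * (y - iter n.+1 f x) <= r /\
    iter n.+1 f (x + c * (y - iter n.+1 f x)) = y.
Proof.
move=> gapP Df fP; elim: n => [|n IH] x p r p' r' Dx xL gpr gpr' xpr fxpr.
  by apply: fP gpr gpr' xpr fxpr.
have [p1 [r1 [g1 fx1]]] := gapP _ (Df _ Dx) (xL 1).
have fxL i : ~ L (iter i f (f x)) by rewrite -iterSr; apply: xL.
move: fxpr; rewrite iterSr => fxpr.
have [e e1 eP] := IH _ _ _ _ _ (Df _ Dx) fxL g1 gpr' fx1 fxpr.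
have [c c1 cP] := fP _ _ _ _ _ Dx gpr g1 xpr fx1.
exists (c * e) => [|y /eP[yin ey]].
  by rewrite normrM -[ltRHS]mulr1 ltr_pM.
have := cP _ yin; rewrite addrAC subrr add0r mulrA => -[y1 y2].
by split => //; rewrite iterSr y2.
Qed.

(** A long orbit has two points in one gap by pigeonhole; along it the 2^k-th
    iterate has two distinct inverse branches over that gap. *)
Lemma pow2_periods_lattice (R : realType) (a b h : R) (f : R -> R) :
  let D := `[a, b]%classic in let L := lattice a h in
  0 < h -> a < b -> L b ->
  (forall x, D x -> D (f x)) -> (forall x, D x -> L x -> L (f x)) ->
  gap_branches L D f ->
  periods D f <> range (fun n : nat => (2 ^ n)%N).
Proof.
move=> D L h0 ab Lb Df Lf fP.
have DE x : D x = (a <= x <= b) by rewrite /D /= in_itv.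
have hn : h != 0 by rewrite gt_eqF.
apply/eqP; apply/negP => /eqP perE.
pose cell x := Num.truncn ((x - a) / h).
pose Q := cell b.
pose k := Q.+1.
have : periods D f (2 ^ k)%N by rewrite perE; exists k.
set P := (2 ^ k)%N.
have P0 : (0 < P)%N by rewrite expn_gt0.
have QP : (Q.+1 < P)%N by exact: ltn_expl.
move=> [x Dx xP]; have [_ fPx xmin] := xP.
have Di i : D (iter i f x) by elim: i => //= i; apply: Df.
have cellQ i : (cell (iter i f x) < Q.+1)%N.
  have := Di i; rewrite DE => /andP[_ xb].
  by rewrite ltnS le_truncn // ler_pM2r ?invr_gt0 // lerB.
have /injectivePn[i [j ij tE]] :
    ~~ injectiveb (fun i : 'I_P => inord (cell (iter i f x)) : 'I_Q.+1).
  apply/negP => /injectiveP /leq_card; rewrite !card_ord => PQ.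
  by move: QP; rewrite ltnNge PQ.
have {tE} cellE : cell (iter i f x) = cell (iter j f x).
  by move/(congr1 val): tE; rewrite /= !inordK.
have iterP_all q n : iter (q * P) f (iter n f x) = iter n f x.
  rewrite -iterD addnC iterD; congr (iter n f _).
  by elim: q => //= q IH; rewrite mulSn iterD IH.
have uv : iter i f x != iter j f x.
  apply/eqP => e.
  wlog ltij : i j ij cellE e / (i < j)%N.
    move=> H; case: (ltngtP i j) => [|lt|/ord_inj eij]; first exact: H.
      by apply: (H j i) => //; rewrite eq_sym.
    by rewrite eij eqxx in ij.
  apply: (xmin (P - j + i)%N).
    have := ltn_ord j; lia.
  rewrite iterD e -iterD subnK //; exact: ltnW.
(* By periodicity and invariance, an orbit meeting L lies in L. *)
have Lall n m : L (iter n f x) -> L (iter m f x).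
  move=> Ln; rewrite -[iter m f x](iterP_all n m) -iterD.
  have : (n <= n * P + m)%N by rewrite (leq_trans _ (leq_addr _ _)) // leq_pmulr.
  move/subnK <-; rewrite iterD; elim: (_ - n)%N => //= q IH.
  by apply: Lf => //; rewrite -iterD.
(* Two lattice points in the same cell coincide, so the orbit of u and v
   cannot lie in L. *)
have notL n : ~ L (iter n f x).
  move=> Ln; move/eqP: uv; apply.
  have cellK m : (cell (iter m f x))%:R = (iter m f x - a) / h.
    have : L (iter m f x) by apply: Lall Ln.
    rewrite /L /lattice /cell /= => Lm.
    apply/eqP; rewrite -natrE natrEint Lm /=.
    by rewrite divr_ge0 ?subr_ge0 ?(ltW h0) //; have := Di m; rewrite DE => /andP[].
  have : (iter i f x - a) / h = (iter j f x - a) / h by rewrite -!cellK cellE.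
  by move/(mulIf (invr_neq0 hn))/addIr.
have Da m : a <= iter m f x by have := Di m; rewrite DE => /andP[].
have [gu uin] := lattice_gap h0 (Da i) (notL i).
have [gv vin] := lattice_gap h0 (Da j) (notL j).
move: gu uin gv vin; rewrite -/(cell _) -/(cell (iter j f x)) -cellE.
set p := a + _ * h; set r := a + _ * h => gpr upr _ vpr.
have gapP y : D y -> ~ L y -> exists p r, is_gap L p r /\ p < y < r.
  rewrite DE => /andP[ay _] yL; eexists; eexists; exact: lattice_gap.
have fixP m : iter P f (iter m f x) = iter m f x.
  by rewrite -[P]mul1n iterP_all.
have branch m : p < iter m f x < r -> exists2 c, `|c| < 1 &
    forall y, p <= y <= r ->
    p <= iter m f x + c * (y - iter m f x) <= r /\
    iter P f (iter m f x + c * (y - iter m f x)) = y.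
  move=> mpr.
  have mL q : ~ L (iter q f (iter m f x)) by rewrite -iterD.
  have := @iter_gap_branches _ L D f P.-1 gapP Df fP _ p r p r (Di m) mL gpr gpr mpr.
  by rewrite prednK // fixP; apply.
have [c c1 cP] := branch _ upr; have [e e1 eP] := branch _ vpr.
have pr : p <= r by case: gpr => _ _ /ltW.
have [z [zpr z3 z1]] := affine_horseshoe_period3 uv c1 e1 pr cP eP.
have [n fn] := period3_not_pow2 z3 z1.
apply; rewrite -perE; exists z => //; rewrite DE.
have La : L a by rewrite /L /lattice /= subrr mul0r.
case: gpr => _ _ _ pgap.
have := Di i; rewrite DE => /andP[ax xb].
case/andP: upr => px xr; case/andP: zpr => pz zr.
apply/andP; split.
  have [ap|ra] := pgap _ La; first exact: le_trans pz.
  by have := lt_le_trans xr (le_trans ra ax); rewrite ltxx.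
have [bp|rb] := pgap _ Lb; last exact: le_trans rb.
by have := lt_le_trans px (le_trans xb bp); rewrite ltxx.
Qed.

(** * The sawtooth map on its laps *)

Lemma lattice_affine (R : realType) (a h : R) (n x y z : R) :
  n \is a Num.int -> lattice a h x -> lattice a h y -> lattice a h z ->
  lattice a h (x + n * (y - z)).
Proof.
rewrite /lattice /= => ni xL yL zL.
have -> : (x + n * (y - z) - a) / h =
    (x - a) / h + n * ((y - a) / h - (z - a) / h) by ring.
by rewrite rpredD // rpredM // rpredB.
Qed.

Lemma lap_slope_int (R : realType) (d : nat) (e : bool) :
  pm e * d.+1%:R \is a @Num.int R.
Proof. by rewrite rpredM ?natr_int // /pm; case: e; rewrite ?rpredN ?rpred1. Qed.

Lemma cpt0 (R : realType) (a b : R) (d : nat) : cpt a b d 0 = a.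
Proof. by rewrite /cpt mul0r addr0. Qed.

Lemma cpt_last (R : realType) (a b : R) (d : nat) : cpt a b d d.+1 = b.
Proof. by rewrite /cpt mulrC divfK ?pnatr_eq0 // addrC subrK. Qed.

Lemma cptS (R : realType) (a b : R) (d k : nat) :
  cpt a b d k.+1 = cpt a b d k + (b - a) / d.+1%:R.
Proof. by rewrite /cpt -natr1 mulrDl mul1r addrA. Qed.

Lemma cpt_ltS (R : realType) (a b : R) (d k : nat) :
  a < b -> cpt a b d k < cpt a b d k.+1.
Proof. by move=> ab; rewrite cptS ltrDl divr_gt0 ?subr_gt0 ?ltr0n. Qed.

Lemma exists_lap (R : realType) (a b : R) (d : nat) (x : R) :
  a <= x <= b -> exists k : 'I_d.+1, cpt a b d k <= x <= cpt a b d k.+1.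
Proof.
move=> /andP[ax xb].
have ex : exists k, x <= cpt a b d k.+1 by exists d; rewrite cpt_last.
case: (ex_minnP ex) => k xk kmin.
have kd : (k < d.+1)%N by rewrite ltnS kmin ?cpt_last.
exists (Ordinal kd); rewrite /= xk andbT.
case: k xk kmin kd => [|k] xk kmin kd; first by rewrite cpt0.
by rewrite leNgt; apply/negP => /ltW/kmin; rewrite ltnn.
Qed.

Lemma sawtooth_itv (R : realType) (a b : R) (d : nat) (s : 'I_d.+1 -> bool)
    (x : R) :
  a < b -> alternating_shape s -> a <= x <= b -> a <= sawtooth a b s x <= b.
Proof.
move=> ab hs /(exists_lap d)[k xk]; rewrite (sawtooth_lap ab hs xk).
move: xk; rewrite cptS => /andP[kx xk].
have D0 : 0 < d.+1%:R :> R by rewrite ltr0n.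
have : 0 <= d.+1%:R * (x - cpt a b d k) <= b - a.
  by rewrite mulr_ge0 ?subr_ge0 ?(ltW D0) //= mulrC -ler_pdivlMr // lerBlDl.
rewrite -mulrA; set t := d.+1%:R * _.
by rewrite /pm; case: (s k) => /andP[? ?]; apply/andP; split; lra.
Qed.

(** At the two neighbours of a local maximum the sawtooth map takes its minimum
    a, and at those of a local minimum its maximum b; so the cut at c_{i+1} does
    nothing at the outer ends of its two laps. *)
Lemma sawtooth_neighbour (R : realType) (a b : R) (d : nat)
    (s : 'I_d.+1 -> bool) (i : 'I_d) (x : R) :
  a < b -> alternating_shape s -> x = cpt a b d i \/ x = cpt a b d i.+2 ->
  sawtooth a b s x = if sign_at s i then a else b.
Proof.
move=> ab hs [] ->.
  rewrite (@sawtooth_lap _ _ _ _ _ (widen_ord (leqnSn d) i)) //=.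
    by rewrite subrr mulr0 addr0.
  by rewrite lexx ltW ?cpt_ltS.
have sE : s (lift ord0 i) = ~~ sign_at s i by apply: hs.
rewrite (@sawtooth_lap _ _ _ _ _ (lift ord0 i)) //=; last first.
  by rewrite /bump /= add1n lexx andbT ltW ?cpt_ltS.
rewrite sE /bump /= add1n cptS -mulrA [_ + _ / _]addrC addrK.
rewrite [d.+1%:R * _]mulrC divfK ?pnatr_eq0 // /pm.
by case: sign_at => /=; ring.
Qed.

(** * The stunted sawtooth map *)

Definition cut {R : realType} (a b : R) (d : nat) (s : 'I_d.+1 -> bool)
    (w : 'rV[R]_d) (x v : R) (i : 'I_d) : R :=
  if cpt a b d i <= x <= cpt a b d i.+2 then
    if sign_at s i then Num.min v (w 0 i) else Num.max v (w 0 i)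
  else v.

Lemma cut_or (R : realType) (a b : R) (d : nat) (s : 'I_d.+1 -> bool)
    (w : 'rV[R]_d) (x v : R) (i : 'I_d) :
  cut a b s w x v i = v \/ cut a b s w x v i = w 0 i.
Proof.
rewrite /cut; case: ifP => _; last by left.
by case: ifP => _; [rewrite /Num.min|rewrite /Num.max]; case: ifP; auto.
Qed.

Lemma foldl_cut_in (R : realType) (a b : R) (d : nat) (s : 'I_d.+1 -> bool)
    (w : 'rV[R]_d) (x v : R) (P : R -> Prop) (r : seq 'I_d) :
  (forall i, P (w 0 i)) -> P v -> P (foldl (cut a b s w x) v r).
Proof.
move=> wP; elim: r v => //= i r IH v vP; apply: IH.
by have [->|->] := cut_or a b s w x v i.
Qed.

Lemma foldl_cut_id (R : realType) (a b : R) (d : nat) (s : 'I_d.+1 -> bool)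
    (w : 'rV[R]_d) (x v : R) (r : seq 'I_d) :
  (forall i, i \in r -> cut a b s w x v i = v) ->
  foldl (cut a b s w x) v r = v.
Proof.
elim: r => //= i r IH fixv.
rewrite fixv ?mem_head // IH // => j jr; rewrite fixv // inE jr orbT //.
Qed.

(** A cut that changes the value replaces it by a height w_j, and the later
    cuts then keep it in P; so a final value outside P was never cut. *)
Lemma foldl_cut_notin (R : realType) (a b : R) (d : nat) (s : 'I_d.+1 -> bool)
    (w : 'rV[R]_d) (x v : R) (P : R -> Prop) (r : seq 'I_d) :
  (forall i, P (w 0 i)) -> ~ P (foldl (cut a b s w x) v r) ->
  forall i, i \in r -> cut a b s w x v i = v.
Proof.
move=> wP; elim: r => //= i r IH; have [ci|->] := cut_or a b s w x v i; last first.
  by case; apply: foldl_cut_in.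
by rewrite ci => nP j; rewrite inE => /orP[/eqP ->//|]; apply: IH.
Qed.


(** Where f x is off the lattice no cut acts at x, so f agrees near x with the
    affine map T of the lap of x.  The inverse of T maps the gap of f x into the
    gap of x, because T maps the lattice to itself.  No cut acts on the image
    either: the heights lie in the lattice, so they are on the same side of the
    whole gap of f x as they are of f x. *)
Lemma stunted_gap_branches (R : realType) (a b h : R) (d : nat)
    (s : 'I_d.+1 -> bool) (w : 'rV[R]_d) :
  a < b -> (0 < d)%N -> alternating_shape s ->
  (forall k, lattice a h (cpt a b d k)) ->
  (forall i, a <= w 0 i <= b) -> (forall i, lattice a h (w 0 i)) ->
  gap_branches (lattice a h) `[a, b]%classic (stunted a b s w).
Proof.
move=> ab d0 hs cL wab wL x p r p' r' /=; rewrite in_itv /= => xab.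
move=> [pL rL pr pgap] [_ _ _ pgap'] /andP[px xr] fxin.
have [k xk] := exists_lap d xab.
have [/andP[kx xk1]] := (xk).
set L := lattice a h in cL wL pL rL pgap pgap' *.
pose e := if s k then a else b.
pose K : R := pm (s k) * d.+1%:R.
pose T t := e + K * (t - cpt a b d k).
have TE t : cpt a b d k <= t <= cpt a b d k.+1 -> sawtooth a b s t = T t.
  exact: sawtooth_lap.
have stuntedE t : stunted a b s w t =
  foldl (cut a b s w t) (sawtooth a b s t) (enum 'I_d) by [].
have fxL : ~ L (stunted a b s w x).
  move: fxin => /andP[pf fr] /pgap'[] H.
    by have := lt_le_trans pf H; rewrite ltxx.
  by have := lt_le_trans fr H; rewrite ltxx.
have cutx : forall i, cut a b s w x (T x) i = T x.
  move=> i; rewrite -TE //; apply: (@foldl_cut_notin _ a b d s w x _ L (enum 'I_d)) => //.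
  by rewrite mem_enum.
have fxE : stunted a b s w x = T x.
  by rewrite stuntedE TE // foldl_cut_id.
rewrite fxE in fxin *; set v := T x in fxin cutx *.
have {fxin} /andP[pv vr] := fxin.
have D1 : 1 < d.+1%:R :> R by rewrite ltr1n.
have K1 : 1 < `|K| by rewrite /K normrM normr_nat /pm; case: (s k); rewrite ?normrN normr1 mul1r.
have K0 : K != 0 by rewrite -normr_gt0 (lt_trans _ K1).
exists K^-1 => [|y /andP[py yr]].
  by rewrite normfV invf_lt1 // (lt_trans _ K1).
set x' := x + _.
have TL l : L l -> L (T l).
  move=> Ll; apply: lattice_affine (lap_slope_int _ _ _) _ Ll (cL k).
  by rewrite /e -/L; have := cL 0; have := cL d.+1; rewrite cpt0 cpt_last; case: (s k).
have Tx' : T x' = y.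
  have -> : T x' = v + K * (x' - x) by rewrite /v /T; ring.
  have -> : x' - x = K^-1 * (y - v) by rewrite /x'; ring.
  by rewrite mulrA divff // mul1r; ring.
(* T would send a lattice point between x and x' to one strictly between the
   points v and y of the closed gap [p', r']. *)
have nobetween : forall l, L l -> x < l < x' \/ x' < l < x -> False.
  move=> l /TL /pgap' Tl lx.
  have vT : v = T x by [].
  move: Tl; rewrite /T in vT Tx' *.
  have := K0; rewrite neq_lt => /orP[] K0' [] Tl; case: lx => /andP[l1 l2]; nra.
have x'in : p <= x' <= r.
  rewrite !leNgt; apply/andP; split; apply/negP => H.
    by apply: (nobetween p pL); right; rewrite H.
  by apply: (nobetween r rL); left; rewrite xr.
split=> //; have /andP[px' x'r] := x'in.
have x'k : cpt a b d k <= x' <= cpt a b d k.+1.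
  apply/andP; split.
    by have [H|H] := pgap _ (cL k); [exact: le_trans px'|lra].
  by have [H|H] := pgap _ (cL k.+1); [lra|exact: le_trans H].
rewrite stuntedE TE // Tx' foldl_cut_id // => i _.
have := cutx i; rewrite /cut; case: ifP => // xi; last case: ifP => // x'i _; last first.
  (* x' is in the two laps cut by w_i but x is not: x' is one of their outer
     ends. *)
  have x'E : x' = cpt a b d i \/ x' = cpt a b d i.+2.
    have /andP[ix xi2] := x'i; move/negbT: xi; rewrite negb_and -!ltNge => /orP[] H.
      left; apply/eqP; rewrite eq_le ix andbT.
      by have [H1|H1] := pgap _ (cL i); [lra|exact: le_trans H1].
    right; apply/eqP; rewrite eq_le xi2 /=.
    by have [H1|H1] := pgap _ (cL i.+2); [exact: le_trans px'|lra].
  have := sawtooth_neighbour ab hs x'E; rewrite TE // Tx' => ->.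
  by have /andP[wa wb] := wab i; case: (sign_at s i); [apply/min_idPl|apply/max_idPl].
move=> fix_v; case: ifP => // _; move: fix_v.
case: (sign_at s i) => [/min_idPl vw|/max_idPl wv]; have [wp|rw] := pgap' _ (wL i).
- lra.
- exact/min_idPl/(le_trans yr).
- exact/max_idPl/(le_trans wp).
- lra.
Qed.

Lemma stunted_itv (R : realType) (a b : R) (d : nat)
    (s : 'I_d.+1 -> bool) (w : 'rV[R]_d) (x : R) :
  a < b -> alternating_shape s -> (forall i, a <= w 0 i <= b) ->
  a <= x <= b -> a <= stunted a b s w x <= b.
Proof.
move=> ab hs wab xab.
by apply: (@foldl_cut_in _ a b d s w x _ (fun t => a <= t <= b)) => //; exact: sawtooth_itv.
Qed.

Lemma stunted_lattice (R : realType) (a b h : R) (d : nat)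
    (s : 'I_d.+1 -> bool) (w : 'rV[R]_d) (x : R) :
  a < b -> alternating_shape s -> (forall k, lattice a h (cpt a b d k)) ->
  (forall i, lattice a h (w 0 i)) ->
  a <= x <= b -> lattice a h x -> lattice a h (stunted a b s w x).
Proof.
move=> ab hs cL wL xab xL.
apply: (@foldl_cut_in _ a b d s w x _ (lattice a h)) => //.
have [k xk] := exists_lap d xab; rewrite (sawtooth_lap ab hs xk).
apply: lattice_affine (lap_slope_int _ _ _) _ xL (cL k).
by have := cL 0; have := cL d.+1; rewrite cpt0 cpt_last; case: (s k).
Qed.

Lemma stunted_lattice_periods (R : realType) (a b : R) (d N : nat)
    (s : 'I_d.+1 -> bool) (w : 'rV[R]_d) :
  let h := (b - a) / d.+1%:R / N.+1%:R in
  a < b -> (0 < d)%N -> alternating_shape s ->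
  (forall i, a <= w 0 i <= b) -> (forall i, lattice a h (w 0 i)) ->
  periods `[a, b]%classic (stunted a b s w) <>
    range (fun n : nat => (2 ^ n)%N).
Proof.
move=> h ab d0 hs wab wL.
have h0 : 0 < h by rewrite !divr_gt0 ?subr_gt0 ?ltr0n.
have cL k : lattice a h (cpt a b d k).
  rewrite /lattice /= /cpt addrAC subrr add0r.
  have -> : (b - a) / d.+1%:R = N.+1%:R * h by rewrite [RHS]mulrC divfK ?pnatr_eq0.
  by rewrite mulrA mulfK ?gt_eqF // -natrM natr_int.
apply: (@pow2_periods_lattice _ a b h) => //.
- by have := cL d.+1; rewrite cpt_last.
- by move=> x /=; rewrite !in_itv /=; apply: stunted_itv.
- by move=> x /=; rewrite !in_itv /=; apply: stunted_lattice.
- exact: stunted_gap_branches.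
Qed.

(** * Approximation by critical value vectors with lattice entries *)

Definition round_row {R : realType} (a h : R) (d : nat) (w : 'rV[R]_d) : 'rV[R]_d :=
  \row_i (a + (Num.floor ((w 0 i - a) / h))%:~R * h).

Lemma round_rowP (R : realType) (a h : R) (d : nat) (w : 'rV[R]_d) (i : 'I_d) :
  0 < h -> a <= w 0 i ->
  [/\ lattice a h (round_row a h w 0 i), a <= round_row a h w 0 i &
      w 0 i - h < round_row a h w 0 i <= w 0 i].
Proof.
move=> h0 aw; rewrite mxE; set m := Num.floor _.
have hn : h != 0 by rewrite gt_eqF.
have /andP[] := floor_itv ((w 0 i - a) / h); rewrite -/m.
rewrite ler_pdivlMr // ltr_pdivrMr // intrD mulrDl mul1r => mw wm.
split; last by apply/andP; split; lra.
- by rewrite /lattice /= addrAC subrr add0r mulfK // intr_int.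
- by rewrite lerDl mulr_ge0 ?(ltW h0) // ler0z -(floor0 R) le_floor // divr_ge0 ?subr_ge0 // ltW.
Qed.

(** Rounding moves both entries down by less than their distance, so it keeps
    strict inequalities. *)
Lemma round_row_critical (R : realType) (a b h : R) (d : nat)
    (s : 'I_d.+1 -> bool) (w : 'rV[R]_d) :
  0 < h -> (forall i j : 'I_d, w 0 i != w 0 j -> h <= `|w 0 i - w 0 j|) ->
  critical_value_vectors a b s w -> critical_value_vectors a b s (round_row a h w).
Proof.
move=> h0 hw [wab wlt].
have wP i : a <= w 0 i by case/andP: (wab i).
split=> [i|i j ij].
  have [_ -> /andP[_ wi]] := round_rowP h0 (wP i).
  by case/andP: (wab i) => _; exact: le_trans.
have [_ _ /andP[i1 i2]] := round_rowP h0 (wP i).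
have [_ _ /andP[j1 j2]] := round_rowP h0 (wP j).
have wij := wlt _ _ ij.
have /hw : w 0 i != w 0 j.
  by apply/eqP => e; move: wij; rewrite e subrr mul0r ltxx.
move: wij; rewrite /pm; case: (sign_at s j).
  by rewrite !mulr1 => wij; rewrite ltr0_norm // => ?; lra.
by rewrite !mulrN1 !oppr_lt0 => wij; rewrite gtr0_norm // => ?; lra.
Qed.

Theorem corollary1 (R : realType) (a b : R) (hab : a < b)
    (d : nat) (hd : (0 < d)%N) (s : 'I_d.+1 -> bool) (hs : alternating_shape s) :
  let W := critical_value_vectors a b s in
  @interior (subspace W)
    [set w | W w /\ periods `[a, b]%classic (stunted a b s w) =
                    range (fun n : nat => (2 ^ n)%N)] = set0.
Proof.
move=> W; apply/seteqP; split => // w.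
set A := [set _ | _] => wA.
have [Ww _] : A w by exact: nbhs_singleton wA.
have : within W (@nbhs 'rV[R]_d 'rV[R]_d w) A.
  by rewrite (@nbhs_subspace_in 'rV[R]_d W w Ww).
rewrite /within /= => /nbhs_ballP[e e0 eA].
pose del : R := \big[Num.min/1]_(ij : 'I_d * 'I_d | w 0 ij.1 != w 0 ij.2)
  `|w 0 ij.1 - w 0 ij.2|.
have del0 : 0 < del.
  by apply: lt_bigmin => // -[i j] /= ij; rewrite normr_gt0 subr_eq0.
pose m := Num.min e del.
have m0 : 0 < m by rewrite lt_min e0.
pose c := (b - a) / d.+1%:R.
have c0 : 0 < c by rewrite divr_gt0 ?subr_gt0 ?ltr0n.
pose N := Num.truncn (c / m).
pose h := c / N.+1%:R.
have h0 : 0 < h by rewrite divr_gt0 ?ltr0n.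
have hm : h < m.
  have /truncn_itv/andP[_] : 0 <= c / m by rewrite divr_ge0 // ltW.
  by rewrite -/N ltr_pdivrMr // mulrC -ltr_pdivrMr ?ltr0n.
move: (hm); rewrite lt_min => /andP[he hdel].
have Ww' : W (round_row a h w).
  apply: round_row_critical => // i j ij; apply: (le_trans (ltW hdel)).
  by apply: (@bigmin_le_cond _ _ _ 1 (i, j)).
case: (Ww) => wab _; have wa i : a <= w 0 i by case/andP: (wab i).
have [_ ] : A (round_row a h w).
  apply: eA => //; split=> // i j; rewrite /ball /= ord1.
  by have [_ _ /andP[? ?]] := round_rowP h0 (wa j); rewrite ger0_norm; lra.
apply: (@stunted_lattice_periods _ _ _ _ N) => //; first by case: Ww'.
by move=> i; have [] := round_rowP h0 (wa i).
Qed.
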